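(* Let $n\ge1$ and $\pi\in\mathcal L_{n,n}$. Then $\operatorname{dinv}_C(\pi)=\operatorname{area}(\zeta_C(\pi))$.
   Context: $\mathcal L_{n,n}$: words in $\{N,E\}$ with $n$ letters of each kind; $\mathcal B_{2n}$: words of length $2n$ whose prefixes have at least as many $N$'s as $E$'s. A valley of a path is a pair $(i,j)$ such that its $i$-th $E$ is immediately followed by its $j$-th $N$; also, if a ballot path with $i$ East and $j$ North steps ends with an East step, $(i,j+1)$ counts as a valley. For $a\in\mathbb Z^n$, $j\ge0$: $\overrightarrow{S}^+_j(a)$ reads $a$ left to right writing $N$ for entries $j$ and $E$ for entries $j+1$; $\overleftarrow{S}^+_j(a)$ reads right to left; $\overrightarrow{S}^-_j,\overleftarrow{S}^-_j$ likewise with $N$ for $-j$, $E$ for $-j-1$. For $\pi\in\mathcal L_{n,n}$: $\lambda_i$ = number of East steps before the $i$-th North step; $\mu_i=(n+1-i)-\lambda_{n+1-i}$ (type $C_n$ area vector); $\zeta_C(\pi)=\overleftarrow{S}^-_n(\mu)\overrightarrow{S}^+_n(\mu)\cdots\overleftarrow{S}^-_0(\mu)\overrightarrow{S}^+_0(\mu)$. Root system $C_n$: $\Phi^+=\{\pm e_i+e_j:1\le i<j\le n\}\cup\{2e_i:i\in[n]\}$ with partial order $\alpha\le\beta$ iff $\beta-\alpha$ is a sum of positive roots. For $\beta\in\mathcal B_{2n}$ and a valley $(i,j)$ let $\alpha_{i,j}=e_{n+1-i}-e_{n+1-j}$ if $j\le n$, $\alpha_{i,j}=e_{n+1-i}+e_{j-n}$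 if $j>n$; $A_\beta=\{\alpha_{i,j}\}$ over all valleys. $\operatorname{area}(\beta)=|I_\beta|$ where $I_\beta=\{x\in\Phi^+:$ there is no $y\in A_\beta$ with $y\le x\}$. $\operatorname{dinv}_C(\pi)$ is the sum of $\#\{(i,j):i<j,\ \mu_{n-i+1}=\mu_{n-j+1}\}$, $\#\{(i,j):i<j,\ \mu_{n-i+1}=\mu_{n-j+1}+1\}$, $\#\{(i,j):i<j,\ \mu_{n-i+1}=-\mu_{n-j+1}\}$, $\#\{(i,j):i<j,\ \mu_{n-i+1}=-\mu_{n-j+1}+1\}$ and $\#\{i:\mu_{n-i+1}=0\}$, where $i,j$ range over $[n]$. *)

(* Defs.v *)
From HB Require Import structures.
From mathcomp Require Import all_boot all_order all_algebra finmap boolp zify.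

Set Implicit Arguments.
Unset Strict Implicit.
Unset Printing Implicit Defensive.

Import Order.TTheory GRing.Theory Num.Theory.

Local Open Scope fset_scope.
Local Open Scope ring_scope.

Inductive step := North | East.

Definition step_to_bool (s : step) : bool :=
  match s with North => true | East => false end.

Definition bool_to_step (b : bool) : step := if b then North else East.

Lemma step_to_boolK : cancel step_to_bool bool_to_step.
Proof. by case. Qed.

HB.instance Definition _ := Equality.copy step (can_type step_to_boolK).

Definition lattice_path (n : nat) (w : seq step) : bool :=
  (count_mem North w == n) && (count_mem East w == n).

Definition ballot_path (m : nat) (w : seq step) : bool :=
  (size w == m) &&
  all (fun k => (count_mem East (take k w) <= count_mem North (take k w))%N)
      (iota 0 (size w).+1).

Definition lambdas (pi : seq step) : seq nat :=
  [seq count_mem East (take k pi) | k <- iota 0 (size pi)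
     & nth East pi k == North].

(* The indices i of lambda and mu are 1-based, hence the predecessor. *)
Definition lambda (pi : seq step) (i : nat) : nat := nth 0%N (lambdas pi) i.-1.

Definition mu (n : nat) (pi : seq step) (i : nat) : int :=
  (n.+1 - i)%N%:Z - (lambda pi (n.+1 - i))%:Z.

Definition area_vector (n : nat) (pi : seq step) : seq int :=
  [seq mu n pi i | i <- iota 1 n].

(* Reads [a] left to right, writing N for each entry x, E for each entry y. *)
Definition reading (x y : int) (a : seq int) : seq step :=
  pmap (fun z => if z == x then Some North
                 else if z == y then Some East else None) a.

Definition Splus_right (j : nat) (a : seq int) : seq step :=
  reading j%:Z (j%:Z + 1) a.

Definition Sminus_left (j : nat) (a : seq int) : seq step :=
  reading (- j%:Z) (- j%:Z - 1) (rev a).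

Definition zetaC (n : nat) (pi : seq step) : seq step :=
  let a := area_vector n pi in
  flatten [seq Sminus_left j a ++ Splus_right j a | j <- rev (iota 0 n.+1)].

(* 1-based standard basis vector of Z^n *)
Definition stdvec (n k : nat) : 'rV[int]_n := \row_(m < n) (m.+1 == k)%:R.

Definition pos_roots (n : nat) : {fset 'rV[int]_n} :=
  [fset x in
    [seq stdvec n j + stdvec n i | i <- iota 1 n, j <- iota i.+1 (n - i)] ++
    [seq stdvec n j - stdvec n i | i <- iota 1 n, j <- iota i.+1 (n - i)] ++
    [seq stdvec n i *+ 2 | i <- iota 1 n]].

(* The empty sum is allowed, so that the relation is reflexive. *)
Definition root_le (n : nat) (a b : 'rV[int]_n) : Prop :=
  exists s : seq 'rV[int]_n,
    {subset s <= pos_roots n} /\ b - a = \sum_(x <- s) x.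

(* The last summand treats a final East step as if it were followed by one more
   North step; this list is meant for ballot paths only. *)
Definition valleys (beta : seq step) : seq (nat * nat) :=
  [seq (count_mem East (take k.+1 beta), count_mem North (take k.+2 beta))
     | k <- iota 0 (size beta).-1
     & (nth North beta k == East) && (nth East beta k.+1 == North)] ++
  (if last North beta == East
   then [:: (count_mem East beta, (count_mem North beta).+1)] else [::]).

Definition valley_root (n : nat) (v : nat * nat) : 'rV[int]_n :=
  let: (i, j) := v in
  if (j <= n)%N then stdvec n (n.+1 - i) - stdvec n (n.+1 - j)
  else stdvec n (n.+1 - i) + stdvec n (j - n).

Definition valley_roots (n : nat) (beta : seq step) : seq 'rV[int]_n :=
  [seq valley_root n v | v <- valleys beta].

Definition order_ideal (n : nat) (beta : seq step) : {fset 'rV[int]_n} :=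
  [fset x in pos_roots n
     | `[< ~ exists y, y \in valley_roots n beta /\ root_le y x >]].

(* Meaningful when [ballot_path n.*2 beta]; see [zetaC_ballot]. *)
Definition area (n : nat) (beta : seq step) : nat := #|` order_ideal n beta|.

(* The pair of ordinals (i, j) stands for the 1-based pair (i.+1, j.+1), whence
   the subscript n - i = n - (i.+1) + 1. *)
Definition dinvC (n : nat) (pi : seq step) : nat :=
  let m (i : 'I_n) : int := mu n pi (n - i) in
  (#|[set p : 'I_n * 'I_n | (p.1 < p.2)%N & (m p.1 == m p.2)%R]| +
   #|[set p : 'I_n * 'I_n | (p.1 < p.2)%N & (m p.1 == m p.2 + 1)%R]| +
   #|[set p : 'I_n * 'I_n | (p.1 < p.2)%N & (m p.1 == - m p.2)%R]| +
   #|[set p : 'I_n * 'I_n | (p.1 < p.2)%N & (m p.1 == - m p.2 + 1)%R]| +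
   #|[set i : 'I_n | (m i == 0)%R]|)%N.

Lemma count_reading_N (x y : int) a :
  count_mem North (reading x y a) = count_mem x a.
Proof.
elim: a => //= z a IH; rewrite /reading /=.
by case: (z == x); case: (z == y) => /=; rewrite IH.
Qed.

Lemma count_reading_E (x y : int) a :
  x != y -> count_mem East (reading x y a) = count_mem y a.
Proof.
move=> xy; elim: a => //= z a IH; rewrite /reading /=.
case: (eqVneq z x) => [->|_] /=; first by rewrite (negbTE xy) IH.
by case: (z == y) => /=; rewrite IH.
Qed.

Lemma count_steps (w : seq step) :
  (count_mem North w + count_mem East w)%N = size w.
Proof. by elim: w => //= -[] w /= <-; rewrite ?addnS. Qed.

Definition zeta_level (a : seq int) (j : nat) : seq step :=
  Sminus_left j a ++ Splus_right j a.

Definition abs_count (a : seq int) (j : nat) : nat :=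
  (count_mem (j%:Z) a + count_mem (- j%:Z) a)%N.

Lemma zeta_level_N a j : count_mem North (zeta_level a j) = abs_count a j.
Proof. by rewrite count_cat !count_reading_N count_rev addnC. Qed.

Lemma zeta_level_E a j : count_mem East (zeta_level a j) = abs_count a j.+1.
Proof.
rewrite count_cat !count_reading_E ?count_rev; try lia.
by rewrite addnC /abs_count -[j.+1]addn1 PoszD opprD.
Qed.

Definition nonneg_from (b : nat) (w : seq step) : Prop :=
  forall k, (count_mem East (take k w) <= b + count_mem North (take k w))%N.

Lemma nonneg_from_cat b c w1 w2 :
  (count_mem East w1 <= b)%N -> (count_mem East w1 + c)%N = (b + count_mem North w1)%N ->
  nonneg_from c w2 -> nonneg_from b (w1 ++ w2).
Proof.
move=> le_b bal H k; rewrite take_cat; case: ltnP => _.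
  apply: leq_trans (leq_trans le_b (leq_addr _ _)).
  by rewrite -{2}(cat_take_drop k w1) count_cat leq_addr.
rewrite !count_cat addnA -bal -addnA leq_add2l; exact: H.
Qed.

Lemma zeta_levels_nonneg a m :
  nonneg_from (abs_count a m) (flatten [seq zeta_level a j | j <- rev (iota 0 m)]).
Proof.
elim: m => [|m IH]; first by move=> k.
rewrite -addn1 iotaD /= add0n rev_cat /= addn1.
by apply: (nonneg_from_cat (c := abs_count a m)) IH;
  rewrite zeta_level_E // zeta_level_N.
Qed.

Lemma size_zeta_levels a m :
  all (fun x : int => (`|x| < m)%N) a ->
  size (flatten [seq zeta_level a j | j <- rev (iota 0 m)]) = (size a).*2.
Proof.
have E : forall (f : nat -> nat), sumn (map f (rev (iota 0 m))) = (\sum_(j < m) f j)%N.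
  by move=> f; rewrite map_rev sumn_rev sumnE big_map -{1}[m]subn0 big_mkord.
rewrite size_flatten /shape -map_comp E.
have -> : (\sum_(j < m) (size \o zeta_level a) j
           = \sum_(j < m) (abs_count a j + abs_count a j.+1))%N.
  by apply: eq_bigr => j _ /=; rewrite -count_steps zeta_level_N zeta_level_E.
elim: a => [_|x a IH /= /andP[x_m a_m]].
  by rewrite big1 // => j _; rewrite /abs_count.
have -> : (\sum_(j < m) (abs_count (x :: a) j + abs_count (x :: a) j.+1)
  = \sum_(j < m) (((x == j%:Z) + (x == - j%:Z)) + ((x == j.+1%:Z) + (x == - j.+1%:Z)))
    + \sum_(j < m) (abs_count a j + abs_count a j.+1))%N.
  by rewrite -big_split /=; apply: eq_bigr => j _; rewrite /abs_count /=; lia.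
rewrite IH // doubleS -[(_.*2).+2]add2n; congr addn.
have -> : forall p : nat,
  (\sum_(j < p) (((x == j%:Z) + (x == - j%:Z)) + ((x == j.+1%:Z) + (x == - j.+1%:Z)))
  = if `|x| < p then 2 else ((`|x| == p) && (0 < p)))%N; last by rewrite x_m.
elim=> [|p IHp]; first by rewrite big_ord0 andbF.
by rewrite big_ord_recr /= IHp; do 2 case: ifP => ?; lia.
Qed.

Lemma lambda_le n pi i : lattice_path n pi -> (lambda pi i <= n)%N.
Proof.
move=> /andP[_ /eqP pE]; rewrite /lambda.
have : all (fun l => (l <= n)%N) (lambdas pi).
  rewrite all_map; apply/allP => k _ /=; rewrite -pE.
  by rewrite -{2}(cat_take_drop k pi) count_cat leq_addr.
move/(all_nthP 0%N) => H; case: (ltnP i.-1 (size (lambdas pi))) => [/H //|ge].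
by rewrite nth_default.
Qed.

Lemma zetaC_ballot n pi :
  lattice_path n pi -> ballot_path n.*2 (zetaC n pi).
Proof.
move=> Lpi; have mu_n : all (fun x : int => (`|x| < n.+1)%N) (area_vector n pi).
  rewrite all_map; apply/allP => i; rewrite mem_iota => Hi /=.
  by have := lambda_le (n.+1 - i) Lpi; rewrite /mu; lia.
apply/andP; split.
  by rewrite (size_zeta_levels mu_n) size_map size_iota.
apply/allP => k _; have := @zeta_levels_nonneg (area_vector n pi) n.+1 k.
have out (z : int) : (`|z| = n.+1)%N -> count_mem z (area_vector n pi) = 0%N.
  move=> zn; apply/count_memPn/negP => /(allP mu_n) /=.
  by rewrite zn ltnn.
by rewrite /abs_count !out ?abszN.
Qed.

(* Main.v *)
Require Import Defs.
From mathcomp Require Import all_boot.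
From mathcomp Require Import all_order all_algebra finmap boolp zify ring.

(* Writing a positive root as f_i - f_j with (f_1, ..., f_2n) =
   (e_n, ..., e_1, -e_1, ..., -e_n) and 1 <= i < j <= 2n + 1 - i, the root order
   becomes (i, j) <= (i', j') iff i' <= i and j <= j'.  Row a of the ideal thus
   stops at the number of North steps before the a-th East step, so a ballot
   path with E East steps and inv pairs (North, later East) has area
   inv - binomial(E + 1, 2) + (n - E)^2.

   In zeta_C(pi), let c_j be the number of entries of mu of absolute value j > 0
   and z the number of zeros; level j has c_j North steps (2z for j = 0) and
   c_(j+1) East steps, so E = n - z.  The pairs from different levels contribute
   sum_(j >= k >= 1) c_j c_k, which leaves sum_(j >= 1) binomial(c_j, 2) + z^2:
   the pairs with mu_i = mu_j or mu_i = -mu_j, together with the zeros.  The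
   pairs inside a level are those with mu_i = mu_j + 1 or mu_i = -mu_j + 1. *)

Set Implicit Arguments.
Unset Strict Implicit.
Unset Printing Implicit Defensive.

Import Order.TTheory GRing.Theory Num.Theory.

(** * Sums over pairs of positions of a sequence *)

Fixpoint pair_sum (T : Type) (f : T -> T -> nat) (s : seq T) : nat :=
  if s is x :: s' then \sum_(y <- s') f x y + pair_sum f s' else 0.

Lemma pair_sum_cat (T : Type) (f : T -> T -> nat) s t :
  pair_sum f (s ++ t) =
  pair_sum f s + pair_sum f t + \sum_(x <- s) \sum_(y <- t) f x y.
Proof.
elim: s => [|x s IH] /=; first by rewrite big_nil addn0.
by rewrite IH big_cat big_cons /=; lia.
Qed.

Lemma pair_sum_rev (T : Type) (f : T -> T -> nat) s :
  pair_sum f (rev s) = pair_sum (fun x y => f y x) s.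
Proof.
elim: s => [//|x s IH] /=.
rewrite rev_cons -cats1 pair_sum_cat /= IH big_nil !addn0 addnC big_rev.
by congr addn; apply: eq_bigr => y _; rewrite big_seq1.
Qed.

Lemma eq_in_pair_sum (T : eqType) (f g : T -> T -> nat) s :
  {in s &, f =2 g} -> pair_sum f s = pair_sum g s.
Proof.
elim: s => [//|x s IH] /= fg.
rewrite (IH (sub_in2 _ fg)) => [|y ys]; last by rewrite inE ys orbT.
congr addn; apply: eq_big_seq => y ys.
by apply: fg; rewrite inE ?eqxx ?ys ?orbT.
Qed.

Lemma pair_sumD (T : Type) (f g : T -> T -> nat) s :
  pair_sum (fun x y => f x y + g x y) s = pair_sum f s + pair_sum g s.
Proof. by elim: s => //= x s ->; rewrite big_split /=; lia. Qed.

Lemma pair_sum_sum (T : Type) m (f : nat -> T -> T -> nat) s :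
  \sum_(j < m) pair_sum (f j) s =
  pair_sum (fun x y => \sum_(j < m) f j x y) s.
Proof.
elim: s => [|x s IH] /=; first by rewrite big1.
by rewrite big_split /= IH exchange_big.
Qed.

Lemma pair_sum_nth (T : Type) (x0 : T) (f : T -> T -> nat) s n :
  size s = n ->
  pair_sum f s =
  \sum_(p : 'I_n * 'I_n | p.1 < p.2) f (nth x0 s p.1) (nth x0 s p.2).
Proof.
move=> <-; rewrite -(pair_big_dep xpredT (fun i j : 'I__ => i < j)
  (fun i j => f (nth x0 s i) (nth x0 s j))) /=.
elim: s => [|x s IH]; first by rewrite big_ord0.
rewrite /= big_ord_recl IH; congr addn.
  by rewrite [in RHS]big_mkcond big_ord_recl /= add0n (big_nth x0) big_mkord.
apply: eq_bigr => i _.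
by rewrite [in RHS]big_mkcond big_ord_recl /= add0n -big_mkcond.
Qed.

Lemma card_pairs (T : Type) (x0 : T) (P : T -> T -> bool) s n :
  size s = n ->
  #|[set p : 'I_n * 'I_n | (p.1 < p.2) & P (nth x0 s p.1) (nth x0 s p.2)]| =
  pair_sum P s.
Proof.
move=> sn; rewrite (pair_sum_nth x0 _ sn) -sum1dep_card big_mkcondr.
by apply: eq_bigr => p _; case: ifP.
Qed.

Lemma count_sum (T : Type) (p : pred T) s : count p s = \sum_(x <- s) p x.
Proof. by elim: s => [|x s IH]; rewrite ?big_nil // big_cons /= IH. Qed.

(** Expand the product over pairs of positions: the diagonal gives [predI p q], and each pair of
    distinct positions occurs in both orders. *)
Lemma mul_count (T : Type) (p q : pred T) s :
  count p s * count q s =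
  count (predI p q) s + pair_sum (fun x y => (p x && q y) + (q x && p y)) s.
Proof.
elim: s => //= x s IH.
have -> : \sum_(y <- s) ((p x && q y) + (q x && p y)) =
          p x * count q s + q x * count p s.
  rewrite big_split /= !count_sum !big_distrr /=.
  by congr addn; apply: eq_bigr => y _; rewrite mulnb.
by rewrite mulnDl mulnDr mulnDr IH -mulnb; lia.
Qed.

(** Used to collapse a sum over levels, since an entry determines the only level to which it can
    contribute. *)
Lemma sum_indicator (m k : nat) (b : bool) :
  \sum_(j < m) ((j == k :> nat) && b) = (k < m) && b :> nat.
Proof.
elim: m => [|m IH]; first by rewrite big_ord0.
by rewrite big_ord_recr /= IH; case: b {IH}; lia.
Qed.

Lemma sum_indicatorS (m k : nat) (b : bool) :
  \sum_(j < m) ((j.+1 == k :> nat) && b) = (0 < k <= m) && b :> nat.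
Proof.
elim: m => [|m IH]; first by rewrite big_ord0; case: k.
by rewrite big_ord_recr /= IH; case: b {IH}; lia.
Qed.

(** * Inversions of [zetaC] and their comparison with [dinvC] *)

Definition inversions (w : seq step) : nat :=
  pair_sum (fun u v => (u == North) && (v == East)) w.

Lemma inversions_cat u v :
  inversions (u ++ v) =
  inversions u + inversions v + count_mem North u * count_mem East v.
Proof.
rewrite /inversions pair_sum_cat !count_sum big_distrlr /=.
by congr addn; apply: eq_bigr => x _; apply: eq_bigr => y _; rewrite mulnb.
Qed.

Lemma inversions_reading (x y : int) a : x != y ->
  inversions (reading x y a) = pair_sum (fun u v => (u == x) && (v == y)) a.
Proof.
move=> xy; elim: a => //= z a IH.
rewrite {1}/reading /=; case: (eqVneq z x) => [_|_] /=.
  rewrite /inversions /= -!/(reading x y a) -/(inversions _) IH; congr addn.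
  by rewrite -!count_sum -(count_reading_E _ xy).
rewrite big1_eq add0n -IH; case: eqP => //= _.
by rewrite /inversions /= big1_eq.
Qed.

(** The sums come from pairs inside [Sminus_left], pairs inside [Splus_right], and pairs going from
    the first to the second. The last is a product of counts, without diagonal because [- j] and
    [j + 1] differ. *)
Lemma inversions_zeta_level a j :
  inversions (zeta_level a j) =
  pair_sum (fun x y => (y == - j%:Z) && (x == - j%:Z - 1) : nat)%R a +
  pair_sum (fun x y => (x == j%:Z) && (y == j%:Z + 1) : nat)%R a +
  pair_sum (fun x y => ((x == - j%:Z) && (y == j%:Z + 1)) +
                       ((x == j%:Z + 1) && (y == - j%:Z)) : nat)%R a.
Proof.
rewrite /zeta_level inversions_cat !inversions_reading ?pair_sum_rev; try lia.
rewrite count_reading_N count_reading_E ?count_rev ?mul_count; try lia.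
rewrite (eq_count (a2 := pred0)) ?count_pred0 // => x /=; lia.
Qed.

Lemma count_zeta_levels_E a m :
  count_mem East (flatten [seq zeta_level a j | j <- rev (iota 0 m)]) =
  \sum_(k < m) abs_count a k.+1.
Proof.
elim: m => [|m IH]; first by rewrite big_ord0.
by rewrite -addn1 iotaD rev_cat addn1 /= count_cat IH zeta_level_E big_ord_recr addnC.
Qed.

(** Levels are written in decreasing order, so the North steps of level [j] precede all East steps
    of the levels [k < j]. *)
Lemma inversions_zeta_levels a m :
  inversions (flatten [seq zeta_level a j | j <- rev (iota 0 m)]) =
  \sum_(j < m) (inversions (zeta_level a j)
                + abs_count a j * \sum_(k < j) abs_count a k.+1).
Proof.
elim: m => [|m IH]; first by rewrite big_ord0.
rewrite -addn1 iotaD rev_cat addn1 /= inversions_cat IH count_zeta_levels_E zeta_level_N.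
by rewrite big_ord_recr /= add0n addnAC addnC.
Qed.

(** Doubling a sum over [1 <= k <= j <= m] gives the square plus one extra diagonal. The value [c 0]
    drops out, as its inner sum is empty. *)
Lemma sum_mul_prefix (c : nat -> nat) m :
  2 * \sum_(j < m.+1) c j * \sum_(k < j) c k.+1 =
  (\sum_(j < m) c j.+1) ^ 2 + \sum_(j < m) c j.+1 ^ 2.
Proof.
elim: m => [|m IH]; first by rewrite big_ord_recr !big_ord0 muln0.
rewrite big_ord_recr /= mulnDr IH !(big_ord_recr m) /=; ring.
Qed.

(** At [j = 0] the two counts in [abs_count] coincide, so zeros would be counted twice. *)
Lemma abs_count_pos a j : 0 < j ->
  abs_count a j = count (fun x : int => `|x|%N == j) a.
Proof. by move=> j0; elim: a => //= x a IH; rewrite -IH /abs_count /=; lia. Qed.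

Lemma sum_abs_count a m : all (fun x : int => (`|x| <= m)%N) a ->
  \sum_(j < m) abs_count a j.+1 + count_mem 0%R a = size a.
Proof.
elim: a => [_|x a IH /= /andP[x_m a_m]].
  by rewrite big1 // => j _; rewrite /abs_count.
rewrite (eq_bigr (fun j : 'I_m =>
  ((j.+1 == `|x| :> nat) && true) + abs_count a j.+1)).
  rewrite big_split /= sum_indicatorS -[RHS]addn1 -(IH a_m).
  by move: (\sum_(j < m) _) (count_mem _ _) => S C; lia.
by move=> j _; rewrite !abs_count_pos //=; lia.
Qed.

(* The contribution to dinv_C of x = mu_q and y = mu_p with q < p; the pairs
   (i, j) of dinv_C with i < j read mu from right to left. *)
Definition dinv_pair (x y : int) : nat :=
  ((y == x)%R + (y == x + 1)%R + (y == - x)%R + (y == - x + 1)%R)%N.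

Lemma inversions_zeta a m :
  all (fun x : int => (`|x| <= m)%N) a ->
  let z := count_mem 0%R a in
  inversions (flatten [seq zeta_level a j | j <- rev (iota 0 m.+1)]) + z ^ 2 =
  pair_sum dinv_pair a + z + 'C((size a - z).+1, 2).
Proof.
move=> a_m z.
set E := \sum_(j < m) abs_count a j.+1.
have Ez : size a - z = E by rewrite -(sum_abs_count a_m) addnK.
rewrite Ez inversions_zeta_levels big_split /=.
(* A square [c_j ^ 2] is [c_j] plus twice the number of pairs inside the class of absolute value
   [j]. *)
have sq : \sum_(j < m) abs_count a j.+1 ^ 2 =
  E + 2 * pair_sum (fun x y : int => (`|x|%N == `|y|%N) && (x != 0%R) : nat) a.
  rewrite (eq_bigr (fun j : 'I_m => abs_count a j.+1 + 2 *
      pair_sum (fun x y : int => (`|x|%N == j.+1) && (`|y|%N == j.+1) : nat) a)).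
    rewrite big_split /= -big_distrr /= (pair_sum_sum m (fun j (x y : int) =>
      (`|x|%N == j.+1) && (`|y|%N == j.+1) : nat)).
    congr (_ + 2 * _); apply: eq_in_pair_sum => x y xa ya.
    rewrite (eq_bigr (fun j : 'I_m => ((j.+1 == `|x| :> nat) &&
       (`|x|%N == `|y|%N) : nat))) ?sum_indicatorS.
      by have := allP a_m _ xa; lia.
    by move=> j _; lia.
  move=> j _; rewrite abs_count_pos // -mulnn mul_count; congr addn.
    by apply: eq_count => x /=; rewrite andbb.
  by rewrite mul2n -addnn -pair_sumD; apply: eq_in_pair_sum => x y _ _ /=; lia.
have zz : z ^ 2 = z + 2 *
    pair_sum (fun x y : int => (x == 0%R) && (y == 0%R) : nat) a.
  rewrite -mulnn mul_count; congr addn; first by apply: eq_count => x /=; rewrite andbb.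
  by rewrite mul2n -addnn -pair_sumD; apply: eq_in_pair_sum => x y _ _ /=; lia.
have := sum_mul_prefix (abs_count a) m; rewrite sq -/E.
set S := \sum_(j < m.+1) _ * _ => eqS.
(* Twice the binomial is [E.+1 * E], the part [E ^ 2 + E] of [eqS]. *)
have := mul_bin_diag E.+1 1; rewrite bin1 => /= bE.
(* A pair of zeros counts twice, satisfying both [y == x] and [y == - x]; a nonzero pair of equal
   absolute value satisfies exactly one of them. *)
have -> : pair_sum dinv_pair a =
  \sum_(j < m.+1) inversions (zeta_level a j) +
  pair_sum (fun x y : int => (`|x|%N == `|y|%N) && (x != 0%R) : nat) a +
  2 * pair_sum (fun x y : int => (x == 0%R) && (y == 0%R) : nat) a.
  rewrite (eq_bigr _ (fun (j : 'I_m.+1) _ => inversions_zeta_level a j)).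
  rewrite !big_split /=.
  rewrite (pair_sum_sum m.+1 (fun j (x y : int) =>
     (y == - j%:Z) && (x == - j%:Z - 1) : nat)%R).
  rewrite (pair_sum_sum m.+1 (fun j (x y : int) =>
     (x == j%:Z) && (y == j%:Z + 1) : nat)%R).
  rewrite (pair_sum_sum m.+1 (fun j (x y : int) =>
     ((x == - j%:Z) && (y == j%:Z + 1)) + ((x == j%:Z + 1) && (y == - j%:Z)) : nat)%R).
  rewrite mul2n -addnn -!pair_sumD; apply: eq_in_pair_sum => x y xa ya.
  have := allP a_m _ xa; have := allP a_m _ ya => /= y_m x_m.
  rewrite (eq_bigr (fun j : 'I_m.+1 => ((j == `|y| :> nat) &&
       ((y <= 0)%R && (x == y - 1)%R) : nat))) ?sum_indicator; last by move=> j _; lia.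
  rewrite (eq_bigr (fun j : 'I_m.+1 => ((j == `|x| :> nat) &&
       ((0 <= x)%R && (y == x + 1)%R) : nat))) ?sum_indicator; last by move=> j _; lia.
  rewrite big_split /=.
  rewrite (eq_bigr (fun j : 'I_m.+1 => ((j == `|x| :> nat) &&
       ((x <= 0)%R && (y == - x + 1)%R) : nat))) ?sum_indicator; last by move=> j _; lia.
  rewrite (eq_bigr (fun j : 'I_m.+1 => ((j == `|y| :> nat) &&
       ((y <= 0)%R && (y == - x + 1)%R) : nat))) ?sum_indicator; last by move=> j _; lia.
  rewrite /dinv_pair !ltnS x_m y_m /=.
  (* If [y = x + 1], exactly one of [0 <= x] and [y <= 0] holds; if [y = - x + 1], exactly one of
     [x <= 0] and [y <= 0]. *)
  have -> : (y == x + 1)%R = ((y <= 0)%R && (x == y - 1)%R) +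
                             ((0 <= x)%R && (y == x + 1)%R) :> nat by lia.
  have -> : (y == - x + 1)%R = ((x <= 0)%R && (y == - x + 1)%R) +
                               ((y <= 0)%R && (y == - x + 1)%R) :> nat by lia.
  have : (y == x)%R + (y == - x)%R = ((`|x|%N == `|y|%N) && (x != 0%R)) +
    ((x == 0%R) && (y == 0%R)) + ((x == 0%R) && (y == 0%R)) by lia.
  by move=> e; rewrite [X in X + _ = _]addnAC e; ring.
move: eqS; rewrite zz -mulnn.
move: (pair_sum _ _) (pair_sum _ _) (\sum_(j < m.+1) _) => p q s eqS; lia.
Qed.

Lemma dinvC_pair_sum n pi :
  dinvC n pi = pair_sum dinv_pair (area_vector n pi)
               + count_mem 0%R (area_vector n pi).
Proof.
set a := area_vector n pi.
have sa : size (rev a) = n by rewrite size_rev size_map size_iota.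
have nth_a (i : 'I_n) : mu n pi (n - i) = nth 0%R (rev a) i.
  have lt_i : n - i.+1 < n by have := ltn_ord i; lia.
  rewrite nth_rev size_map size_iota // (nth_map 0) ?size_iota // nth_iota //.
  by congr mu; have := ltn_ord i; lia.
have H (P : int -> int -> bool) :
  #|[set p : 'I_n * 'I_n | (p.1 < p.2) & P (mu n pi (n - p.1)) (mu n pi (n - p.2))]|
  = pair_sum (fun x y => P y x) a.
  rewrite -pair_sum_rev -(card_pairs 0%R P sa).
  by apply: eq_card => p; rewrite !inE !nth_a.
rewrite /dinvC (H (fun x y => x == y)) (H (fun x y => x == y + 1)%R)
  (H (fun x y => x == - y)%R) (H (fun x y => x == - y + 1)%R) -!pair_sumD.
congr addn.
rewrite -count_rev count_sum (big_nth 0%R) sa big_mkord -sum1dep_card big_mkcond.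
by apply: eq_bigr => i _; rewrite nth_a /=; case: ifP.
Qed.

(** * Positive roots and the root order in terms of cells *)

(** For [1 <= k <= 2n], the term [f_k] of (e_n, ..., e_1, -e_1, ..., -e_n); it merges the two
    branches of [valley_root]. *)
Definition signed_vec (n k : nat) : 'rV[int]_n :=
  if k <= n then stdvec n (n.+1 - k) else (- stdvec n (k - n))%R.

Lemma valley_rootE n i j : i <= n ->
  valley_root n (i, j) = (signed_vec n i - signed_vec n j)%R.
Proof.
by rewrite /valley_root /signed_vec => ->; case: ifP => _; rewrite ?opprK.
Qed.

(* The index pairs (i, j), i < j <= 2n + 1 - i, of the positive roots; those with
   i + j = 2n + 1 give the long roots 2e_(n+1-i). *)
Definition cells (n : nat) : seq (nat * nat) :=
  [seq (i, j) | i <- iota 1 n, j <- iota i.+1 ((n - i).*2).+1].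

Lemma mem_cells n c :
  (c \in cells n) = [&& 0 < c.1, c.1 < c.2 & c.1 + c.2 <= n.*2.+1].
Proof.
apply/allpairsPdep/idP => [[i [j [+ + ->]]]|].
  by rewrite !mem_iota /=; lia.
by move=> H; exists c.1, c.2; rewrite !mem_iota -surjective_pairing; split => //; lia.
Qed.

Lemma uniq_cells n : uniq (cells n).
Proof.
apply: allpairs_uniq_dep => [|i _|]; rewrite ?iota_uniq //.
by move=> [i j] [i' j'] _ _ /= [-> ->].
Qed.

Lemma pos_rootsP n x :
  reflect (exists2 c, c \in cells n & x = valley_root n c) (x \in pos_roots n).
Proof.
rewrite in_fset !mem_cat; apply: (iffP idP).
  case/or3P => [/allpairsPdep|/allpairsPdep|/mapP].
  - move=> [i [j [+ + ->]]]; rewrite !mem_iota => hi hj.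
    exists (n.+1 - j, n + i); first by rewrite mem_cells /=; lia.
    rewrite /valley_root ifF; last lia.
    by congr (stdvec n _ + stdvec n _)%R; lia.
  - move=> [i [j [+ + ->]]]; rewrite !mem_iota => hi hj.
    exists (n.+1 - j, n.+1 - i); first by rewrite mem_cells /=; lia.
    rewrite /valley_root ifT; last lia.
    by congr (stdvec n _ - stdvec n _)%R; lia.
  - move=> [i + ->]; rewrite !mem_iota => hi.
    exists (n.+1 - i, n + i); first by rewrite mem_cells /=; lia.
    rewrite /valley_root ifF ?mulr2n; last lia.
    by congr (stdvec n _ + stdvec n _)%R; lia.
move=> [[i j]]; rewrite mem_cells /= => hc ->.
case: ifP => jn.
  apply/or3P/Or32/allpairsPdep; exists (n.+1 - j), (n.+1 - i).
  by rewrite !mem_iota; split => //; lia.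
case: (ltngtP (j - n) (n.+1 - i)) => hij; last 1 first.
- apply/or3P/Or33/mapP; exists (j - n); first by rewrite mem_iota; lia.
  by rewrite -hij mulr2n.
- apply/or3P/Or31/allpairsPdep; exists (j - n), (n.+1 - i).
  by rewrite !mem_iota; split => //; lia.
- lia.
Qed.

(** If [k + l > 2n + 1], the symmetry [f_(2n+1-k) = - f_k] replaces [(k, l)] by the cell
    [(2n+1-l, 2n+1-k)] of the same difference. *)
Lemma signed_vecB_root n k l : 0 < k -> k < l -> l <= n.*2 ->
  (signed_vec n k - signed_vec n l)%R \in pos_roots n.
Proof.
move=> k0 kl ln; apply/pos_rootsP.
case: (leqP (k + l) n.*2.+1) => H.
  exists (k, l); first by rewrite mem_cells /=; lia.
  by rewrite valley_rootE //; lia.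
exists (n.*2.+1 - l, n.*2.+1 - k); first by rewrite mem_cells /=; lia.
have signed_vecN i : 0 < i <= n.*2 ->
    signed_vec n (n.*2.+1 - i) = (- signed_vec n i)%R.
  rewrite /signed_vec => hi; case: (leqP i n) => hin.
    by rewrite ifF; [congr (- stdvec n _)%R|]; lia.
  by rewrite ifT ?opprK; [congr (stdvec n _)|]; lia.
rewrite valley_rootE; last lia.
by rewrite !signed_vecN ?opprK 1?addrC //; lia.
Qed.

(* Nonnegative on every positive root, hence monotone for the root order; on the
   roots these functionals determine the order. *)
Definition tail_sum (n m : nat) (x : 'rV[int]_n) : int :=
  (\sum_(k < n | (m <= k.+1)%N) x 0 k)%R.

Lemma tail_sum_stdvec n m k : 0 < k <= n ->
  tail_sum m (stdvec n k) = (m <= k)%:R%R.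
Proof.
move=> /andP[k0 kn]; have kn' : k.-1 < n by lia.
rewrite /tail_sum big_mkcond (bigD1 (Ordinal kn')) //= big1 => [|i ne].
  by rewrite mxE /= prednK // eqxx addr0; case: ifP.
rewrite mxE; case: ifP => //= _.
by have : i != k.-1 :> nat by []; case: eqP => //; lia.
Qed.

Lemma tail_sumD n m (x y : 'rV[int]_n) :
  tail_sum m (x + y)%R = (tail_sum m x + tail_sum m y)%R.
Proof. by rewrite -big_split; apply: eq_bigr => i _; rewrite mxE. Qed.

Lemma tail_sumN n m (x : 'rV[int]_n) : tail_sum m (- x)%R = (- tail_sum m x)%R.
Proof. by rewrite -sumrN; apply: eq_bigr => i _; rewrite mxE. Qed.

Lemma tail_sum_cell n m i j : (i, j) \in cells n ->
  tail_sum m (valley_root n (i, j)) =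
  ((m + i <= n.+1)%N%:Z + (if (j <= n)%N then - (m + j <= n.+1)%N%:Z
                         else (m + n <= j)%N%:Z))%R.
Proof.
rewrite mem_cells /= => hc.
by case: ifP => jn; rewrite tail_sumD ?tail_sumN !tail_sum_stdvec; try lia;
  congr (_%:R + _)%R; rewrite ?natz; lia.
Qed.

Lemma root_le_tail_sum n m (a b : 'rV[int]_n) :
  root_le a b -> (tail_sum m a <= tail_sum m b)%R.
Proof.
move=> [s [sub eq_s]]; rewrite -subr_ge0 -tail_sumN -tail_sumD eq_s {eq_s}.
elim: s sub => [_|x s IH sub].
  by rewrite big_nil /tail_sum sumr_ge0 // => i _; rewrite mxE.
rewrite big_cons tail_sumD addr_ge0 //; last first.
  by apply: IH => y ys; apply: sub; rewrite inE ys orbT.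
have /pos_rootsP[[i j] hc ->] := sub _ (mem_head _ _).
by rewrite tail_sum_cell //; move: hc; rewrite mem_cells /=; case: ifP; lia.
Qed.

(** The [f_k] are not roots, but [root_le] compares arbitrary vectors; this lets the two ends of a
    cell move independently. *)
Lemma signed_vec_le n k l : 0 < k -> k <= l -> l <= n.*2 ->
  root_le (signed_vec n l) (signed_vec n k).
Proof.
move=> k0; rewrite leq_eqVlt => /predU1P[-> _|kl ln].
  by exists [::]; rewrite big_nil subrr.
exists [:: signed_vec n k - signed_vec n l]%R; rewrite big_seq1; split => // x.
by rewrite inE => /eqP->; apply: signed_vecB_root.
Qed.

Lemma root_leD n (a b c d : 'rV[int]_n) :
  root_le a b -> root_le c d -> root_le (a + c)%R (b + d)%R.
Proof.
move=> [s [sub_s eq_s]] [t [sub_t eq_t]]; exists (s ++ t); split.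
  by move=> x; rewrite mem_cat => /orP[/sub_s|/sub_t].
by rewrite big_cat /= -eq_s -eq_t opprD addrACA.
Qed.

Lemma root_leN n (a b : 'rV[int]_n) : root_le a b -> root_le (- b)%R (- a)%R.
Proof. by move=> [s [sub_s eq_s]]; exists s; rewrite opprK addrC. Qed.

Lemma root_le_cells n c d : c \in cells n -> d \in cells n ->
  root_le (valley_root n c) (valley_root n d) <->
  (d.1 <= c.1) && (c.2 <= d.2).
Proof.
case: c d => [i j] [i' j'] hc hd.
have c_ij := hc; have d_ij := hd; rewrite !mem_cells /= in c_ij d_ij.
split => [le_cd|/andP[ii jj]].
  have T m := root_le_tail_sum m le_cd.
  (* The value [n.+1 - i], the largest index in the first root, forces [i' <= i]. The value 1
     excludes [j' <= n < j], where the sums are 2 and 0. For [j <= j'], [n.+1 - j'] serves when both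
     are at most [n], and [j - n] when both exceed [n]. *)
  have := T (n.+1 - i); have := T (n.+1 - j'); have := T 1; have := T (j - n).
  by rewrite !tail_sum_cell //=; do 2 case: ifP => ?; lia.
rewrite /= in ii jj; rewrite !valley_rootE; try lia.
by apply: root_leD; last apply: root_leN; apply: signed_vec_le; lia.
Qed.

(** Equal roots are comparable in both directions, which forces equal cells. *)
Lemma valley_root_inj n : {in cells n &, injective (valley_root n)}.
Proof.
move=> c d hc hd eq_cd.
have refl x : root_le x x :> Prop by exists [::]; rewrite big_nil subrr.
have [+ _] := root_le_cells hc hd; have [+ _] := root_le_cells hd hc.
rewrite eq_cd; case: c d {hc hd eq_cd} => [i j] [i' j'] /= H1 H2.
by move: (H1 (refl n _)) (H2 (refl n _)) => ? ?; congr pair; lia.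
Qed.

(** * Valleys and prefixes of a word *)

(** Counting North steps only up to the East step, then adding one, treats inner valleys and a final
    East step alike. *)
Lemma valleysP w i j :
  reflect (exists k, [/\ nth North w k == East,
                         (k.+1 == size w) || (nth East w k.+1 == North),
                         i = count_mem East (take k.+1 w) &
                         j = (count_mem North (take k.+1 w)).+1])
          ((i, j) \in valleys w).
Proof.
(* Each default differs from the letter sought, so a match puts the index in range. *)
have ltE k : nth North w k == East -> k < size w.
  by case: ltnP => // ge; rewrite nth_default.
have ltN k : nth East w k == North -> k < size w.
  by case: ltnP => // ge; rewrite nth_default.
rewrite mem_cat; apply: (iffP orP) => [[|]|[k [kE]]].
- move=> /mapP[k]; rewrite mem_filter => /andP[/andP[kE kN] _] [-> ->].
  exists k; rewrite kE kN orbT; split => //.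
  by rewrite (take_nth East (ltN _ kN)) (eqP kN) -cats1 count_cat addn1.
- case: ifP => // lE; rewrite inE => /eqP[-> ->].
  have w0 : 0 < size w by case: (w) lE.
  exists (size w).-1; rewrite prednK // eqxx take_size.
  by rewrite nth_last.
- have klt := ltE k kE.
  case: eqP => [ksz _|ksz /= kN] -> ->.
    by right; rewrite -nth_last -ksz /= kE ksz take_size mem_head.
  left; apply/mapP; exists k.
    by rewrite mem_filter kE kN mem_iota; have := ltN _ kN; lia.
  by rewrite (take_nth East (ltN _ kN)) (eqP kN) -cats1 count_cat addn1.
Qed.

Definition has_prefix (w : seq step) (a b : nat) : Prop :=
  exists k, a <= count_mem East (take k w) /\ count_mem North (take k w) < b.

(** A witnessing prefix can be cut back to its last East step, which exists since [0 < a]. The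
    longest witness ending in an East step is followed by a North step or by the end of the word. *)
Lemma has_prefix_valley w a b : 0 < a ->
  has_prefix w a b <-> exists v, [/\ v \in valleys w, a <= v.1 & v.2 <= b].
Proof.
move=> a0; split => [[k [ka kb]]|[[i j] [/valleysP[k [_ _ -> ->]] /= ai jb]]];
  last by exists k.+1.
pose P k := [&& nth North w k == East, a <= count_mem East (take k.+1 w)
              & count_mem North (take k.+1 w) < b].
have exP : exists k, P k.
  elim: k ka kb => [|k IH]; first by rewrite take0 leqNgt a0.
  case: (ltnP k (size w)) => kw; last first.
    by rewrite !take_oversize // in IH *; lia.
  case E : (nth North w k).
    rewrite (take_nth North kw) -cats1 !count_cat E /= => ka kb.
    by apply: IH; move: ka kb; rewrite !addn0 ?addn1 // => _ /ltnW.
  by move=> ka kb; exists k; rewrite /P E ka kb.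
have ubP k' : P k' -> k' <= size w.
  by case: (leqP k' (size w)) => // lt; rewrite /P nth_default // ltnW.
case: (ex_maxnP exP ubP) => {}k /and3P[kE {}ka {}kb] maxk.
exists (count_mem East (take k.+1 w), (count_mem North (take k.+1 w)).+1).
split=> //; apply/valleysP; exists k; split=> //.
case: (ltngtP k.+1 (size w)) => //= [lt|gt].
  rewrite (set_nth_default North) //; case E : (nth North w k.+1) => //.
  suff /maxk : P k.+1 by rewrite ltnn.
  by rewrite /P E (take_nth North lt) -cats1 !count_cat E /= !addn0 addn1 kb leqW.
by move: kE; rewrite nth_default.
Qed.

(** * Row lengths of the ideal and the area *)

(** Entry [a], counted from 0, is the number of North steps before the East step number [a.+1]. *)
Fixpoint heights (w : seq step) : seq nat :=
  if w is s :: w' then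
    if s is North then map succn (heights w') else 0 :: heights w'
  else [::].

Lemma size_heights w : size (heights w) = count_mem East w.
Proof. by elim: w => // -[] w /= <-; rewrite ?size_map. Qed.

Lemma sumn_heights w : sumn (heights w) = inversions w.
Proof.
elim: w => // -[] w IH; rewrite /inversions /= -/(inversions w) -IH.
  rewrite -count_sum -size_heights.
  by elim: (heights w) => //= h t IHt; rewrite IHt; lia.
by rewrite big1_eq.
Qed.

Lemma heights_le w h : h \in heights w -> h <= count_mem North w.
Proof.
elim: w h => // -[] w IH h /=; first by move=> /mapP[h' /IH le ->].
by rewrite inE => /predU1P[->|/IH].
Qed.

(** Among the prefixes with at least [a.+1] East steps, the one ending at the East step number
    [a.+1] has the fewest North steps. *)
Lemma has_prefix_heights w a b :
  has_prefix w a.+1 b <-> a < size (heights w) /\ nth 0 (heights w) a < b.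
Proof.
elim: w a b => [|s w IH] a b; first by split => [[k []]|[]].
have -> : has_prefix (s :: w) a.+1 b <->
          exists k, a < (s == East) + count_mem East (take k w) /\
                    (s == North) + count_mem North (take k w) < b.
  by split => [[[|k] [ka kb]] //|[k H]]; [exists k|exists k.+1].
case: s => /=.
  case: b => [|b]; first by split => [[k []]|[]].
  rewrite size_map; split => [[k [ka kb]]|[ha hb]].
    have [|ha hb] := (IH a b).1; first by exists k.
    by rewrite (nth_map 0).
  rewrite (nth_map 0) // in hb.
  by have [k [ka kb]] := (IH a b).2 (conj ha hb); exists k.
case: a => [|a] /=; last exact: IH.
split => [[k [_ kb]]|[_ b0]]; first by rewrite (leq_ltn_trans _ kb).
by exists 0; rewrite take0.
Qed.

Lemma ballot_prefix n w k : ballot_path n.*2 w ->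
  count_mem East (take k w) <= count_mem North (take k w).
Proof.
move=> /andP[_ /allP B]; case: (leqP k (size w)) => kw.
  by apply: B; rewrite mem_iota.
rewrite take_oversize ?(ltnW kw) //.
by have := B (size w); rewrite take_size; apply; rewrite mem_iota ltnSn.
Qed.

(** The ballot condition just after the East step gives [i < j], and the length [2n] gives
    [i + j <= 2n + 1]. *)
Lemma valley_cell n w v :
  ballot_path n.*2 w -> v \in valleys w -> v \in cells n.
Proof.
move=> Bw; case: v => i j /valleysP[k [kE _ -> ->]]; rewrite mem_cells /=.
have kw : k < size w by case: ltnP kE => // ge; rewrite nth_default.
have sz : count_mem North w + count_mem East w = n.*2.
  by rewrite count_steps; case/andP: Bw => /eqP.
rewrite ltnS (ballot_prefix _ Bw); apply/andP; split.
  by rewrite (take_nth North kw) (eqP kE) -cats1 count_cat addnS.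
rewrite -sz addnS ltnS addnC /= -{3 4}(cat_take_drop k.+1 w) !count_cat.
by apply: leq_add; apply: leq_addr.
Qed.

(** [valley_root] maps [cells n] bijectively to the positive roots, and lying above a valley root
    becomes [has_prefix]. *)
Lemma area_cells n w : ballot_path n.*2 w ->
  area n w = count (fun c => `[< ~ has_prefix w c.1 c.2 >]) (cells n).
Proof.
move=> Bw; rewrite -size_filter -(size_map (valley_root n)).
set good := filter _ _.
have good_cells : {subset good <= cells n} by move=> c; rewrite mem_filter => /andP[].
have mem_ideal x : (x \in order_ideal n w) = (x \in pos_roots n) &&
    `[< ~ exists y, y \in valley_roots n w /\ root_le y x >].
  by rewrite !inE.
have -> : area n w = #|` [fset x in map (valley_root n) good]%fset|.
  congr #|` _|; apply/fsetP => x; rewrite mem_ideal [in RHS]in_fset.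
  apply/andP/mapP => [[/pos_rootsP[c hc ->] /asboolP noy]|[c + ->]].
    exists c => //; rewrite mem_filter hc andbT; apply/asboolP => pre.
    apply: noy; move: (hc); rewrite mem_cells => /andP[c1 _].
    have [v [hv ci cj]] := (has_prefix_valley _ _ c1).1 pre.
    exists (valley_root n v); split; first exact: map_f.
    by apply/(root_le_cells (valley_cell Bw hv) hc); rewrite ci cj.
  rewrite mem_filter => /andP[/asboolP nopre hc]; split.
    by apply/pos_rootsP; exists c.
  apply/asboolP => -[_ [/mapP[v hv ->]]].
  move=> /(root_le_cells (valley_cell Bw hv) hc) /andP[ci cj].
  move: (hc); rewrite mem_cells => /andP[c1 _].
  by apply: nopre; apply/has_prefix_valley => //; exists v.
rewrite card_fseq undup_id // map_inj_in_uniq ?filter_uniq ?uniq_cells //.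
by move=> c d /good_cells hc /good_cells hd; apply: valley_root_inj.
Qed.

Lemma count_leq_iota h m l : count (fun b => b <= h) (iota m l) = minn l (h.+1 - m).
Proof. by elim: l m => [|l IH] m //=; rewrite ?IH; lia. Qed.

Lemma sum_odd d : \sum_(i < d) ((d - i.+1).*2).+1 = d ^ 2.
Proof.
elim: d => [|d IH]; first by rewrite big_ord0.
rewrite big_ord_recl (eq_bigr (fun i : 'I_d => ((d - i.+1).*2).+1)) ?IH; last first.
  by move=> i _; rewrite /= /bump; lia.
by rewrite /=; lia.
Qed.

Lemma area_heights n w : ballot_path n.*2 w ->
  area n w + 'C((count_mem East w).+1, 2) =
  inversions w + (n - count_mem East w) ^ 2.
Proof.
move=> Bw; rewrite area_cells // count_flatten -map_comp.
rewrite sumnE big_map -[1]addn0 iotaDl big_map.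
rewrite -[n in iota 0 n]subn0 -/(index_iota 0 n) big_mkord.
set E := count_mem East w.
have sz : count_mem North w + E = n.*2 by rewrite count_steps; case/andP: Bw => /eqP.
have En : E <= n.
  by have := ballot_prefix (size w) Bw; rewrite take_size -/E; lia.
(* This makes the truncated subtraction of [a.+1] in [row] exact. *)
have low a : a < E -> a < nth 0 (heights w) a.
  move=> aE; rewrite ltnNge; apply/negP => le.
  have [k [ka]] : has_prefix w a.+1 a.+1.
    by apply/has_prefix_heights; rewrite size_heights.
  by have := ballot_prefix k Bw; lia.
(* As [a < E], the height stays below [2n - a], the last column of row [a]. *)
have high a : a < E -> nth 0 (heights w) a <= n.*2 - E.
  move=> aE; rewrite -sz addnK; apply: heights_le.
  by rewrite mem_nth // size_heights.
have row a : a < n ->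
  count (fun c => `[< ~ has_prefix w c.1 c.2 >])
        [seq (a.+1, j) | j <- iota a.+2 ((n - a.+1).*2).+1] =
  if a < E then nth 0 (heights w) a - a.+1 else ((n - a.+1).*2).+1.
  move=> an; rewrite count_map; case: ifP => aE.
    rewrite (eq_count (a2 := fun b => b <= nth 0 (heights w) a)); last first.
      move=> b /=; apply/asboolP/idP => [no|le /has_prefix_heights[_]]; last by lia.
      rewrite leqNgt; apply/negP => lt; apply: no.
      by apply/has_prefix_heights; rewrite size_heights.
    by rewrite count_leq_iota; have := low _ aE; have := high _ aE; lia.
  rewrite (eq_count (a2 := predT)) ?count_predT ?size_iota // => b /=.
  by apply/asboolP => /has_prefix_heights[]; rewrite size_heights aE.
rewrite (eq_bigr _ (fun (a : 'I_n) _ => row a (ltn_ord a))).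
rewrite -(big_mkord xpredT (fun a => if a < E then nth 0 (heights w) a - a.+1
                                     else ((n - a.+1).*2).+1)).
rewrite (big_cat_nat _ En) //= addnAC; congr addn; last first.
  rewrite -sum_odd -[E in LHS]add0n big_addn big_mkord.
  by apply: eq_bigr => i _; rewrite ifF; lia.
(* The binomial is the sum of [a.+1] over [a < E], which restores what each row subtracts from its
   height. *)
rewrite -sumn_heights sumnE [in RHS](big_nth 0) size_heights -/E -bin2_sum.
rewrite big_nat_recl // add0n -big_split /= !big_nat.
by apply: eq_bigr => a aE; rewrite ifT; [have := low a | ]; lia.
Qed.

Theorem theorem4p28 (n : nat) (hn : (1 <= n)%N) (pi : seq step)
    (hpi : lattice_path n pi) :
  dinvC n pi = area n (zetaC n pi).
Proof.
set a := area_vector n pi.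
have sa : size a = n by rewrite size_map size_iota.
have a_n : all (fun x : int => `|x| <= n) a.
  rewrite all_map; apply/allP => i; rewrite mem_iota => Hi /=.
  by have := lambda_le (n.+1 - i) hpi; rewrite /mu; lia.
have := area_heights (zetaC_ballot hpi).
have zE : count_mem East (zetaC n pi) + count_mem 0%R a = n.
  rewrite count_zeta_levels_E sum_abs_count //.
  (* East steps of the levels [0] to [n] stand for absolute values up to [n.+1], hence the weaker
     bound. *)
  by apply: sub_all a_n => x /leqW.
have := inversions_zeta a_n; rewrite sa dinvC_pair_sum -/a /=.
have -> : n - count_mem 0%R a = count_mem East (zetaC n pi) by rewrite -[X in X - _]zE addnK.
have -> : n - count_mem East (zetaC n pi) = count_mem 0%R a by rewrite -[X in X - _]zE addKn.
rewrite -/(zetaC n pi) => invE areaE.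
(* Both identities carry the same binomial and the same square, as the number of zeros is [n - E];
   the binomial cancels. *)
by apply/(@addIn 'C((count_mem East (zetaC n pi)).+1, 2)); rewrite areaE -invE.
Qed.
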